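(* Let $p$ be a prime with $p \equiv 1 \pmod 4$, let $e$ be a positive integer, and let $n = p^e$. Then the integer $\mathcal{P}_n$ is coprime to $p$.
   Context: For $n \geq 1$ let $F_n(x) = 1 + x + \frac{x^2}{2} + \cdots + \frac{x^n}{n}$, let $L_n = \operatorname{lcm}\{1,2,\dots,n\}$, and let $\widetilde{F}_n(x) = L_n F_n(x) \in \mathbf{Z}[x]$. Note $F_n'(x) = 1 + x + \cdots + x^{n-1}$, whose roots are the $n-1$ nontrivial $n$-th roots of unity. Define $\mathcal{P}_n = \prod_{\theta} \widetilde{F}_n(\theta)$, the product over all $\theta$ with $F_n'(\theta)=0$ (i.e. all $n$-th roots of unity $\theta \neq 1$); this is an integer. *)

(* Defs.v *)
From mathcomp Require Import all_boot all_order all_algebra all_field.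

Set Implicit Arguments.
Unset Strict Implicit.
Unset Printing Implicit Defensive.

Import Order.TTheory GRing.Theory Num.Theory.
Local Open Scope ring_scope.

Definition F (n : nat) : {poly rat} :=
  1 + \sum_(1 <= i < n.+1) (i%:R)^-1 *: 'X^i.

Definition lcm_upto (n : nat) : nat := \big[lcmn/1%N]_(1 <= i < n.+1) i.

Definition Ftilde (n : nat) : {poly rat} := (lcm_upto n)%:R *: F n.

(* The distinct complex roots of a rational polynomial, each listed once.
   Meaningful only for a nonzero polynomial: see [mem_complex_roots]. *)
Definition complex_roots (q : {poly rat}) : seq algC :=
  undup (sval (closed_field_poly_normal (map_poly ratr q : {poly algC}))).

Definition calP (n : nat) : algC :=
  \prod_(theta <- complex_roots (F n)^`()) (map_poly ratr (Ftilde n)).[theta].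

Lemma mem_complex_roots (q : {poly rat}) (x : algC) :
  q != 0 -> (x \in complex_roots q) = root (map_poly ratr q) x.
Proof.
move=> q0; rewrite /complex_roots mem_undup.
case: (closed_field_poly_normal _) => r /= Dp.
rewrite Dp rootZ ?root_prod_XsubC //.
by rewrite lead_coef_eq0 map_poly_eq0.
Qed.

Lemma complex_roots_uniq (q : {poly rat}) : uniq (complex_roots q).
Proof. exact: undup_uniq. Qed.

Lemma deriv_F (n : nat) : (F n)^`() = \sum_(i < n) 'X^i.
Proof.
rewrite /F derivD derivC add0r big_add1 /= big_mkord raddf_sum.
apply: eq_bigr => i _; rewrite /= derivZ derivXn /= -scaler_nat scalerA mulVf ?scale1r //.
by rewrite pnatr_eq0.
Qed.

Lemma deriv_F_neq0 (n : nat) : (0 < n)%N -> (F n)^`() != 0.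
Proof.
case: n => // n _; rewrite deriv_F; apply/negP => /eqP/(congr1 (coefp 0%N)).
rewrite /= coef0 coef_sum (bigD1 ord0) //= big1 => [|i i0]; last first.
  by rewrite coefXn eq_sym; case: i i0 => -[].
by rewrite addr0 coefXn eqxx => /eqP; rewrite oner_eq0.
Qed.

Lemma mem_complex_roots_deriv_F (n : nat) (x : algC) : (0 < n)%N ->
  (x \in complex_roots (F n)^`()) = (n.-unity_root x) && (x != 1).
Proof.
move=> n0; rewrite mem_complex_roots ?deriv_F_neq0 // deriv_F.
have -> : map_poly ratr (\sum_(i < n) 'X^i) = \sum_(i < n) 'X^i :> {poly algC}.
  by rewrite rmorph_sum; apply: eq_bigr => i _ /=; rewrite map_polyXn.
rewrite /root_of_unity !rootE horner_sum hornerD hornerN hornerXn hornerC.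
rewrite subrX1 mulf_eq0 subr_eq0 (eq_bigr (fun i : 'I_n => x ^+ i)); last first.
  by move=> i _; rewrite hornerXn.
case: (eqVneq x 1) => [->|_] /=; last by rewrite andbT.
rewrite (eq_bigr (fun=> 1)) => [|i _]; last by rewrite expr1n.
by rewrite sumr_const card_ord pnatr_eq0 eqn0Ngt n0.
Qed.

Lemma Ftilde_int (n : nat) : Ftilde n \is a polyOver Num.int.
Proof.
apply/polyOverP => k.
rewrite /Ftilde /F /lcm_upto !big_add1 !big_mkord /= scalerDr scaler_sumr.
rewrite coefD coef_sum rpredD //.
  by rewrite coefZ coef1 -natrM natr_int.
apply: rpred_sum => i _; rewrite scalerA coefZ coefXn rpredM ?natr_int //.
have /dvdnP[c ->] : (i.+1 %| \big[lcmn/1]_(j < n) j.+1)%N.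
  exact: (biglcmn_sup i).
by rewrite natrM mulfK ?natr_int // pnatr_eq0.
Qed.

(* Main.v *)
(** Write [L = lcm(1, ..., n)] with [n = p^e]. The coefficient [L / i] of
    [Ftilde n] is divisible by [p] for [0 < i < n], and so is the constant
    coefficient [L], whereas [c = L / n] is prime to [p]. Hence [Ftilde n] is
    congruent to [c X^n] modulo [p], and takes values congruent to [c] at the
    [n]-th roots of unity, so that [calP n] is congruent to [c^(n-1)].
    To stay within integer arithmetic, [calP n] is realised as the determinant
    of [Ftilde n] evaluated at an integer matrix [A] with characteristic
    polynomial [F_n' = 1 + X + ... + X^(n-1)]; by Cayley-Hamilton [A^n = 1]. *)

Require Import Defs.
From mathcomp Require Import all_boot all_order all_algebra all_field.

Local Open Scope ring_scope.

Import Order.TTheory GRing.Theory Num.Theory.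

(** The companion matrix is the witness; its dimension is only propositionally [k.+1], so it is
    generalized before the size is rewritten. *)
Lemma char_poly_exists (R : comNzRingType) (k : nat) (q : {poly R}) :
  q \is monic -> size q = k.+2 -> exists A : 'M[R]_k.+1, char_poly A = q.
Proof.
move=> q_monic size_q; have := companionmxK q_monic.
by move: (companionmx q); rewrite size_q => A; exists A.
Qed.

Lemma horner_char_poly (R : comNzRingType) (k : nat) (A : 'M[R]_k) (x : R) :
  (char_poly A).[x] = \det (x%:M - A).
Proof.
rewrite -horner_evalE -det_map_mx; congr (\det _); apply/matrixP => i j.
by rewrite !mxE /= horner_evalE hornerD hornerN hornerC hornerMn hornerX.
Qed.

(** Both sides are multiplicative in [f], so splitting [f] into linear factors leaves the constants
    and the case ['X - b%:P], where the determinant is the characteristic polynomial at [b] up to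
    sign. *)
Lemma det_horner_mx (K : closedFieldType) (k : nat) (A : 'M[K]_k.+1)
    (rs : seq K) (f : {poly K}) :
  char_poly A = \prod_(r <- rs) ('X - r%:P) ->
  \det (horner_mx A f) = \prod_(r <- rs) f.[r].
Proof.
move=> charA.
have size_rs : size rs = k.+1.
  by apply: succn_inj; rewrite -(size_char_poly A) charA (size_prod_XsubC rs id).
have prod_const (x : K) : \prod_(r <- rs) x = x ^+ size rs.
  by rewrite big_const_seq count_predT iter_mulr_1.
have [bs ->] := closed_field_poly_normal f.
rewrite -mul_polyC rmorphM /= det_mulmx horner_mx_C det_scalar.
have -> : \det (horner_mx A (\prod_(b <- bs) ('X - b%:P)))
        = \prod_(r <- rs) (\prod_(b <- bs) ('X - b%:P)).[r].
  elim: bs => [|b bs IHbs].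
    by rewrite big_nil rmorph1 det1 big1 // => r _; rewrite hornerC.
  rewrite big_cons rmorphM /= det_mulmx IHbs.
  under [RHS]eq_bigr do rewrite hornerM.
  rewrite big_split /=; congr (_ * _).
  (* The sign [(-1) ^+ k.+1] from [A - b = - (b - A)] is spread over the [k.+1] roots, turning each
     [b - r] into [r - b]. *)
  rewrite rmorphB /= horner_mx_X horner_mx_C -opprB -scaleN1r detZ.
  rewrite -horner_char_poly charA horner_prod -size_rs.
  rewrite -prod_const -big_split /=; apply: eq_bigr => r _.
  by rewrite !hornerE mulN1r opprB.
rewrite -size_rs -prod_const -big_split /=; apply: eq_bigr => r _.
by rewrite hornerM hornerC.
Qed.

Lemma sum_Xn_poly (R : nzRingType) (n : nat) :
  \sum_(i < n) 'X^i = \poly_(i < n) 1 :> {poly R}.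
Proof. by rewrite poly_def; under [RHS]eq_bigr do rewrite scale1r. Qed.

Lemma size_sum_Xn (R : nzRingType) (n : nat) :
  size (\sum_(i < n.+1) 'X^i : {poly R}) = n.+1.
Proof. by rewrite sum_Xn_poly size_poly_eq ?oner_eq0. Qed.

Lemma monic_sum_Xn (R : nzRingType) (n : nat) :
  (\sum_(i < n.+1) 'X^i : {poly R}) \is monic.
Proof. by rewrite monicE sum_Xn_poly lead_coef_poly ?oner_eq0. Qed.

(** The roots are simple, being the powers [z ^+ i], [0 < i < n.+1], of a primitive root of unity;
    hence the duplicate-free list loses no multiplicity. *)
Lemma prod_complex_roots_deriv_F (n : nat) :
  \prod_(x <- complex_roots (F n.+1)^`()) ('X - x%:P)
  = \sum_(i < n.+1) 'X^i :> {poly algC}.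
Proof.
have [z prim_z] := C_prim_root_exists (ltn0Sn n).
have sumE : \prod_(1 <= i < n.+1) ('X - (z ^+ i)%:P)
            = \sum_(i < n.+1) 'X^i :> {poly algC}.
  (* Times ['X - 1], the missing factor of index 0, both sides become ['X^n.+1 - 1]. *)
  apply: (mulfI (x := 'X - 1)); first by rewrite polyXsubC_eq0.
  by rewrite -subrX1 -(factor_Xn_sub_1 prim_z) [RHS]big_ltn // expr0.
rewrite -sumE -(big_map (GRing.exp z) xpredT (fun x => 'X - x%:P)).
apply: perm_big; apply: uniq_perm.
- exact: complex_roots_uniq.
- rewrite map_inj_in_uniq ?iota_uniq // => i j.
  rewrite !mem_index_iota => /andP[_ lt_i] /andP[_ lt_j] /eqP.
  by rewrite (eq_prim_root_expr prim_z) !modn_small // => /eqP.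
move=> x; rewrite mem_complex_roots ?deriv_F_neq0 // deriv_F.
rewrite rmorph_sum /=; under eq_bigr do rewrite map_polyXn.
by rewrite -sumE -(big_map (GRing.exp z) xpredT (fun x => 'X - x%:P))
  root_prod_XsubC.
Qed.

Definition Ftilde_Z (n : nat) : {poly int} :=
  (lcm_upto n)%:R + \sum_(1 <= i < n.+1) (lcm_upto n %/ i)%:R *: 'X^i.

Lemma dvdn_lcm_upto (n i : nat) : (0 < i <= n)%N -> (i %| lcm_upto n)%N.
Proof.
case: i => // i lt_in; rewrite /lcm_upto big_add1 /= big_mkord.
exact: (biglcmn_sup (Ordinal lt_in)).
Qed.

Lemma lcm_upto_dvdP (n m : nat) :
  (forall i, (0 < i <= n)%N -> (i %| m)%N) -> (lcm_upto n %| m)%N.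
Proof.
move=> dvd_m; rewrite /lcm_upto big_add1 /= big_mkord.
by apply/dvdn_biglcmP => i _; apply: dvd_m; rewrite /= ltn_ord.
Qed.

Lemma map_Ftilde_Z (n : nat) : map_poly ratr (Ftilde n)
  = map_poly intr (Ftilde_Z n) :> {poly algC}.
Proof.
rewrite /Ftilde /F /Ftilde_Z scalerDr scaler_sumr !rmorphD !rmorph_sum /=.
congr (_ + _).
  by rewrite rmorph_nat -mul_polyC mulr1 map_polyC /= rmorph_nat polyC_natr.
apply: eq_big_nat => i /andP[i_gt0 le_in].
rewrite scalerA !map_polyZ !map_polyXn /=; congr (_ *: _).
rewrite -[in LHS](divnK (dvdn_lcm_upto n i _)) ?i_gt0 //.
by rewrite natrM mulfK ?rmorph_nat // pnatr_eq0 -lt0n.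
Qed.

Lemma calP_det (n : nat) (A : 'M[int]_n.+1) :
  char_poly A = \sum_(i < n.+2) 'X^i ->
  calP n.+2 = (\det (horner_mx A (Ftilde_Z n.+2)))%:~R.
Proof.
move=> charA; rewrite -det_map_mx map_horner_mx /calP map_Ftilde_Z.
rewrite (@det_horner_mx _ _ _ (complex_roots (F n.+2)^`())) //.
rewrite -map_char_poly charA rmorph_sum prod_complex_roots_deriv_F /=.
by apply: eq_bigr => i _; rewrite map_polyXn.
Qed.

Section PrimePower.

Variables (p e : nat).
Hypotheses (p_pr : prime p).

(** For [i <= p ^ e] the [p]-part of [i] divides [p ^ e] and the rest divides the prime-to-[p] part
    [K] of the factorial, so the lcm divides [K * p ^ e]. *)
Lemma lcm_upto_div_coprime : coprime p (lcm_upto (p ^ e) %/ p ^ e).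
Proof.
have pe_gt0 : (0 < p ^ e)%N by rewrite expn_gt0 prime_gt0.
set K := (((p ^ e)`!)`_p^')%N.
have coK : coprime p K.
  exact: (pnat_coprime (pnat_id p_pr) (part_pnat _ _)).
apply: coprime_dvdr coK; rewrite dvdn_divLR // ?dvdn_lcm_upto ?pe_gt0 ?leqnn //.
apply: lcm_upto_dvdP => i /andP[i_gt0 le_i].
rewrite -(partnC p i_gt0) mulnC; apply: dvdn_mul.
  by apply: partn_dvd; rewrite ?fact_gt0 // dvdn_fact // i_gt0.
rewrite p_part dvdn_exp2l //.
by rewrite -(leq_exp2l _ _ (prime_gt1 p_pr)) (leq_trans (dvdn_leq i_gt0 (pfactor_dvdnn p i))).
Qed.

(** Since [i < p ^ e], its [p]-part times [p] still divides [p ^ e], hence the lcm; the prime-to-[p]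
    part of [i] does too, and these two coprime factors multiply to [p * i]. *)
Lemma dvdn_lcm_upto_div (i : nat) :
  (0 < i < p ^ e)%N -> (p %| lcm_upto (p ^ e) %/ i)%N.
Proof.
case/andP=> i_gt0 lt_i.
have pe_gt0 : (0 < p ^ e)%N by rewrite expn_gt0 prime_gt0.
have dvd_i : (i %| lcm_upto (p ^ e))%N by rewrite dvdn_lcm_upto // i_gt0 ltnW.
rewrite dvdn_divRL // -{1}(partnC p i_gt0) mulnA Gauss_dvd; last first.
  by rewrite p_part -expnS coprimeXl //
    (pnat_coprime (pnat_id p_pr) (part_pnat _ _)).
rewrite (dvdn_trans (dvdn_part _ _) dvd_i) andbT p_part -expnS.
apply: (@dvdn_trans (p ^ e)); last by rewrite dvdn_lcm_upto ?pe_gt0 /=.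
rewrite dvdn_exp2l // -(ltn_exp2l _ _ (prime_gt1 p_pr)).
exact: leq_ltn_trans (dvdn_leq i_gt0 (pfactor_dvdnn p i)) lt_i.
Qed.

Hypothesis e_gt0 : (0 < e)%N.

Lemma map_Ftilde_Z_Fp : map_poly intr (Ftilde_Z (p ^ e))
  = (lcm_upto (p ^ e) %/ p ^ e)%:R *: 'X^(p ^ e) :> {poly 'F_p}.
Proof.
have pe_gt0 : (0 < p ^ e)%N by rewrite expn_gt0 prime_gt0.
have dvd0 k : (p %| k)%N -> k%:R = 0 :> 'F_p.
  by rewrite (dvdn_pcharf (pchar_Fp p_pr)) => /eqP.
(* The constant coefficient vanishes because [0 < e] gives [p %| p ^ e]. *)
rewrite /Ftilde_Z rmorphD rmorph_nat rmorph_sum /= -polyC_natr dvd0; last first.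
  apply: (@dvdn_trans (p ^ e)); first by rewrite -{1}(expn1 p) dvdn_exp2l.
  by rewrite dvdn_lcm_upto ?pe_gt0 /=.
rewrite add0r big_nat_recr //= big_nat big1 => [|i lt_i].
  by rewrite add0r map_polyZ map_polyXn /= rmorph_nat.
by rewrite map_polyZ /= rmorph_nat dvd0 ?scale0r // dvdn_lcm_upto_div.
Qed.

End PrimePower.

Lemma expr_char_poly_sum_Xn (R : comNzRingType) (n : nat) (A : 'M[R]_n.+1) :
  char_poly A = \sum_(i < n.+2) 'X^i -> A ^+ n.+2 = 1.
Proof.
move=> charA; have := Cayley_Hamilton A; rewrite charA => hornerA0.
have := congr1 (horner_mx A) (subrX1 'X n.+2).
rewrite rmorphM /= hornerA0 mulr0 rmorphB rmorphXn /= horner_mx_X rmorph1.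
by move/eqP; rewrite subr_eq0 => /eqP.
Qed.

Theorem theorem3p2 (p e : nat) (hp : prime p) (hp4 : p = 1 %[mod 4])
    (he : (0 < e)%N) :
  exists m : int, calP (p ^ e)%N = m%:~R /\ coprimez m p%:Z.
Proof.
have pe_gt1 : (1 < p ^ e)%N by rewrite -{1}(expn0 p) ltn_exp2l ?prime_gt1.
(* The matrix has size [p ^ e - 1 = n.+1], which is positive. *)
have [n En] : exists n, (p ^ e = n.+2)%N.
  by case: (p ^ e)%N pe_gt1 => [|[|n]] // _; exists n.
have [A charA] :=
  char_poly_exists _ _ _ (monic_sum_Xn int n.+1) (size_sum_Xn int n.+1).
exists (\det (horner_mx A (Ftilde_Z (p ^ e)))).
split; first by rewrite En; apply: calP_det.
set d := \det _.
have dE : d%:~R = (lcm_upto (p ^ e) %/ p ^ e)%:R ^+ n.+1 :> 'F_p.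
  rewrite -det_map_mx map_horner_mx map_Ftilde_Z_Fp // -mul_polyC rmorphM /=.
  rewrite horner_mx_C rmorphXn /= horner_mx_X [in X in _ * X]En expr_char_poly_sum_Xn.
    by rewrite mulr1 det_scalar.
  rewrite -map_char_poly charA rmorph_sum /=.
  by apply: eq_bigr => i _; rewrite map_polyXn.
rewrite coprimezE coprime_sym prime_coprime //=.
rewrite (dvdn_pcharf (pchar_Fp hp)).
(* The goal concerns the absolute value of [d], which differs from [d] by a sign, a unit in
   ['F_p]. *)
suff: d%:~R != 0 :> 'F_p.
  by rewrite [d in d%:~R]intEsign rmorphM /= rmorph_sign mulf_eq0 signr_eq0.
rewrite dE expf_neq0 // -(dvdn_pcharf (pchar_Fp hp)) -prime_coprime //.
exact: lcm_upto_div_coprime.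
Qed.
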